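(* Let $A_i$, $i \in I$, be residually finite groups, let $G = \ast_{i\in I} A_i$ be their free product, and let $N$ be the kernel of the natural homomorphism from $G$ onto the direct product of the groups $A_i$, $i \in I$. Then for each element $h \in N$ the group $G$ is $h$-potent.
   Context: Given a group $G$ and an element $g \in G$, the group $G$ is called $g$-potent if for each natural number $n\ge 1$ there exists a finite index subgroup $H_n \leqslant G$ such that $\langle g\rangle \cap H_n = \langle g^n\rangle$. The natural homomorphism from the free product to the direct product (for infinite $I$: the restricted direct product, consisting of finitely supported families, which is the image) is the one that sends each free factor $A_i$ identically to the $i$-th direct factor. *)

(* Defs.v *)
From HB Require Import structures.
From mathcomp Require Import all_boot fingroup.
From mathcomp Require Import boolp classical_sets functions cardinality.

Set Implicit Arguments.
Unset Strict Implicit.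
Unset Printing Implicit Defensive.

Local Open Scope classical_set_scope.
Local Open Scope group_scope.

Definition residually_finite (G : groupType) : Prop :=
  forall g : G, g != 1 ->
    exists (K : finGroupType) (f : {multiplicative G -> K}), f g != 1.

Definition kernel (G H : groupType) (f : G -> H) : set G :=
  [set x | f x = 1].

Definition zpowers (G : groupType) (g : G) : set G :=
  [set x | exists k : nat, x = g ^+ k \/ x = g ^- k].

Definition finite_index (G : groupType) (H : set G) : Prop :=
  finite_set (range (fun x : G => [set x * y | y in H])).

Definition potent (G : groupType) (g : G) : Prop :=
  forall n : nat, (0 < n)%N ->
    exists H : {pred G},
      [/\ group_closed H,
          finite_index [set` H] &
          zpowers g `&` [set` H] = zpowers (g ^+ n)].

Section Words.
Variables (I : eqType) (A : I -> groupType).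

Definition syllable := {i : I & A i}.
Implicit Types (x y : syllable) (u v w : seq syllable).

Definition reduced w : bool :=
  all (fun x => tagged x != 1) w && sorted (fun x y => tag x != tag y) w.

(* The reduced form of x :: w, for w reduced; tagged_as x y is tagged y seen as
   an element of A (tag x), which is meaningful as tag x = tag y. *)
Definition push x w : seq syllable :=
  if tagged x == 1 then w else
  if w is y :: w' then
    if tag x == tag y then
      let c := tagged x * tagged_as x y in
      if c == 1 then w' else Tagged A c :: w'
    else x :: w
  else [:: x].

Definition inv_syllable x : syllable := Tagged A (tagged x)^-1.
Definition inv_word w := rev (map inv_syllable w).

Lemma reduced_behead x w : reduced (x :: w) -> reduced w.
Proof.
by rewrite /reduced /= => /andP[/andP[_ ->]] /path_sorted ->.
Qed.

Lemma push_red x w : reduced (x :: w) -> push x w = x :: w.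
Proof.
rewrite /reduced /push /= => /andP[/andP[/negPf -> _]].
by case: w => //= y w /andP[/negPf ->].
Qed.

Lemma push_reduced x w : reduced w -> reduced (push x w).
Proof.
rewrite /push; case: ifPn => // x1.
case: w => [|y w]; first by rewrite /reduced /= x1.
case: ifPn => [/eqP xy|xy].
  case: ifPn => [_ /reduced_behead //|c1].
  rewrite /reduced /= c1 /= => /andP[/andP[_ ->] /=].
  by case: w => //= z w; rewrite xy.
by rewrite /reduced /= x1 xy.
Qed.

Lemma push_cat_reduced u w : reduced w -> reduced (foldr push w u).
Proof. by move=> rw; elim: u => //= x u IH; apply: push_reduced. Qed.

Lemma push1 i w : push (Tagged A (1 : A i)) w = w.
Proof. by rewrite /push eqxx. Qed.

Lemma pushM i (a b : A i) w : reduced w ->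
  push (Tagged A a) (push (Tagged A b) w) = push (Tagged A (a * b)) w.
Proof.
move=> rw.
have [->|a1] := eqVneq a 1; first by rewrite push1 mul1g.
have [->|b1] := eqVneq b 1; first by rewrite push1 mulg1.
have pe c v : c != 1 -> push (@Tagged _ i A c) v =
  if v is y :: w' then
    if i == tag y then
      let d := c * tagged_as (Tagged A c) y in
      if d == 1 then w' else Tagged A d :: w'
    else Tagged A c :: v
  else [:: Tagged A c] by rewrite /push => /negPf ->.
have push2 d v : is_true (if v is y :: _ then i != tag y else true) ->
    push (Tagged A a) (@Tagged _ i A d :: v) = push (Tagged A (a * d)) v.
  move=> iv; rewrite pe //= eqxx tagged_asE.
  have [->|ad1] := eqVneq (a * d) 1; first by rewrite push1.
  by rewrite pe //; case: v iv => //= y v /negPf ->.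
rewrite [push (Tagged A b) w]pe //.
case: w rw => [|[j c] w] rw; first exact: push2.
case: ifPn => [/eqP /= ij|ij]; last by rewrite push2.
rewrite -{j}ij in c rw *; rewrite !tagged_asE /=.
have nw : is_true (if w is y :: _ then i != tag y else true).
  by move: rw; rewrite /reduced /=; case: (w) => //= y v /andP[_ /andP[]].
have c1 : c != 1 by move: rw; rewrite /reduced /= => /andP[/andP[]].
have pw d : push (@Tagged _ i A d) (Tagged A c :: w) =
    push (Tagged A (d * c)) w.
  have [->|d1] := eqVneq d 1.
    by rewrite push1 mul1g push_red.
  rewrite pe //= eqxx tagged_asE.
  have [->|dc1] := eqVneq (d * c) 1; first by rewrite push1.
  by rewrite pe //; case: (w) nw => //= y v /negPf ->.
rewrite pw -mulgA.
have [bc|bc] := eqVneq (b * c) 1.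
  by rewrite bc mulg1 pe //; case: (w) nw => //= y v /negPf ->.
by rewrite push2.
Qed.

Lemma foldr_push x u w : reduced w ->
  foldr push w (push x u) = push x (foldr push w u).
Proof.
move=> rw; case: x => i a.
rewrite {2}/push /=; have [->|a1] := eqVneq a 1; first by rewrite push1.
case: u => //= -[j b] u /=; case: ifPn => // /eqP ij.
rewrite -{j}ij in b *; rewrite tagged_asE pushM; last exact: push_cat_reduced.
by case: ifPn => [/eqP ->|//]; rewrite push1.
Qed.

Lemma foldr_push0 w : reduced w -> foldr push [::] w = w.
Proof.
elim: w => //= x w IH rw; rewrite IH ?push_red //; exact: reduced_behead rw.
Qed.

Lemma inv_syllableK : involutive inv_syllable.
Proof. by case=> i a; rewrite /inv_syllable /= invgK. Qed.

Lemma inv_wordK : involutive inv_word.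
Proof.
by move=> w; rewrite /inv_word map_rev revK mapK //; apply: inv_syllableK.
Qed.

Lemma inv_word_reduced w : reduced w -> reduced (inv_word w).
Proof.
rewrite /reduced /inv_word all_rev rev_sorted all_map sorted_map.
move=> /andP[w1 sw]; apply/andP; split.
  by apply: sub_all w1 => x /=; rewrite invg_eq1.
by apply: sub_sorted sw => x y /=; rewrite eq_sym.
Qed.

Lemma inv_wordP w : reduced w -> foldr push w (inv_word w) = [::].
Proof.
elim: w => //= x w IH rw; rewrite /inv_word /= rev_cons foldr_rcons.
rewrite -(push_red rw); case: x rw => i a rw.
have rw' := reduced_behead rw.
by rewrite pushM // mulVg push1; apply: IH.
Qed.

End Words.

Section FreeProduct.
Variables (I : Type) (A : I -> groupType).

(* The index type I is arbitrary: {classic I} is I itself, with a classical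
   decidable equality. *)

Record free_product := FreeProduct {
  word :> seq (@syllable {classic I} A);
  word_reduced : reduced word
}.

HB.instance Definition _ := [isSub for word].
HB.instance Definition _ := [Choice of free_product by <:].

Implicit Types u v w : free_product.

Definition fp_one : free_product := @FreeProduct [::] isT.
Definition fp_mul u v : free_product :=
  FreeProduct (push_cat_reduced u (word_reduced v)).
Definition fp_inv u : free_product :=
  FreeProduct (inv_word_reduced (word_reduced u)).

Fact fp_mulA : associative fp_mul.
Proof.
move=> [u ru] [v rv] [w rw]; apply/val_inj => /=.
by elim: u {ru} => //= x u ->; rewrite foldr_push.
Qed.

Fact fp_mul1 : left_id fp_one fp_mul.
Proof. by move=> u; apply/val_inj. Qed.

Fact fp_mulr1 : right_id fp_one fp_mul.
Proof. by move=> [u ru]; apply/val_inj; rewrite /= foldr_push0. Qed.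

Fact fp_mulV : left_inverse fp_one fp_inv fp_mul.
Proof. by move=> [u ru]; apply/val_inj; rewrite /= inv_wordP. Qed.

Fact fp_mulrV : right_inverse fp_one fp_inv fp_mul.
Proof.
move=> u; rewrite -[X in fp_mul X _](_ : fp_inv (fp_inv u) = u) ?fp_mulV //.
by apply/val_inj; rewrite /= inv_wordK.
Qed.

HB.instance Definition _ := isGroup.Build free_product
  fp_mulA fp_mul1 fp_mulr1 fp_mulV fp_mulrV.

Definition fp_in (i : I) (a : A i) : free_product :=
  FreeProduct (push_reduced (@Tagged {classic I} i A a) (word_reduced fp_one)).

Fact fp_in_is_multiplicative i : {morph @fp_in i : a b / a * b}.
Proof.
move=> a b; apply/val_inj; rewrite /= -pushM //.
by rewrite [RHS]foldr_push //= push_reduced.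
Qed.
HB.instance Definition _ i :=
  isMultiplicative.Build (A i) free_product (@fp_in i)
    (@fp_in_is_multiplicative i).

Section Lift.
Variables (H : groupType) (f : forall i, {multiplicative A i -> H}).

Definition fp_lift (w : free_product) : H :=
  \prod_(x <- word w) f (tag x) (tagged x).

Let ev (s : seq (@syllable {classic I} A)) : H :=
  \prod_(x <- s) f (tag x) (tagged x).

Let f1 i : f i 1 = 1.
Proof. by apply: (mulgI (f i 1)); rewrite -gmulfM !mulg1. Qed.

Let ev_push x s : ev (push x s) = f (tag x) (tagged x) * ev s.
Proof.
case: x => i a; rewrite /push /ev /=.
have [->|a1] := eqVneq a 1; first by rewrite f1 mul1g.
case: s => [|[j b] s]; first by rewrite big_cons big_nil.
case: ifPn => [/eqP /= ij|ij]; last by rewrite !big_cons.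
rewrite -{j}ij in b *; rewrite tagged_asE big_cons /= mulgA -gmulfM.
by case: ifPn => [/eqP ->|_]; rewrite ?big_cons // f1 mul1g.
Qed.

Fact fp_lift_is_multiplicative : {morph fp_lift : u v / u * v}.
Proof.
move=> [u ru] [v rv]; rewrite /fp_lift /= -!/(ev _).
elim: u {ru} => [|x u IH] /=; first by rewrite [ev [::]]big_nil mul1g.
by rewrite ev_push IH [ev (x :: u)]big_cons mulgA.
Qed.
HB.instance Definition _ :=
  isMultiplicative.Build free_product H fp_lift fp_lift_is_multiplicative.

Lemma fp_lift_in i (a : A i) : fp_lift (fp_in a) = f i a.
Proof. by rewrite /fp_lift /= -/(ev _) ev_push [ev _]big_nil mulg1. Qed.

Lemma fp_lift_uniq (g : {multiplicative free_product -> H}) :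
  (forall i (a : A i), g (fp_in a) = f i a) -> g =1 fp_lift.
Proof.
move=> gf [w rw]; elim: w rw => [|[i a] w IH] rw.
  rewrite /fp_lift big_nil; apply: (mulgI (g (FreeProduct rw))).
  rewrite -gmulfM mulg1; congr (g _); exact/val_inj.
have rw' := reduced_behead rw.
have -> : FreeProduct rw = fp_in a * FreeProduct rw'.
  apply/val_inj; rewrite /= [RHS]foldr_push //=.
  by rewrite push_red.
by rewrite gmulfM IH gf fp_lift_is_multiplicative fp_lift_in.
Qed.

End Lift.
End FreeProduct.

Section DirectProduct.
Variables (I : Type) (A : I -> groupType).

Definition full_product := forall i : I, A i.
HB.instance Definition _ := gen_eqMixin full_product.
HB.instance Definition _ := gen_choiceMixin full_product.
Implicit Types f g : full_product.

Let p_one : full_product := fun i => 1.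
Let p_mul f g : full_product := fun i => f i * g i.
Let p_inv f : full_product := fun i => (f i)^-1.

Fact p_mulA : associative p_mul.
Proof. by move=> f g h; apply: functional_extensionality_dep => i; apply: mulgA. Qed.
Fact p_mul1 : left_id p_one p_mul.
Proof. by move=> f; apply: functional_extensionality_dep => i; apply: mul1g. Qed.
Fact p_mulr1 : right_id p_one p_mul.
Proof. by move=> f; apply: functional_extensionality_dep => i; apply: mulg1. Qed.
Fact p_mulV : left_inverse p_one p_inv p_mul.
Proof. by move=> f; apply: functional_extensionality_dep => i; apply: mulVg. Qed.
Fact p_mulrV : right_inverse p_one p_inv p_mul.
Proof. by move=> f; apply: functional_extensionality_dep => i; apply: mulgV. Qed.

HB.instance Definition _ := isGroup.Build full_product
  p_mulA p_mul1 p_mulr1 p_mulV p_mulrV.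

Definition finitely_supported : {pred full_product} :=
  fun f => `[< finite_set [set i | f i <> 1] >].

Fact finitely_supported_group : group_closed finitely_supported.
Proof.
split=> [|f g /asboolP ff /asboolP fg]; apply/asboolP.
  by apply: sub_finite_set (finite_set0 I) => i /=.
have fU : finite_set ([set i | f i <> 1] `|` [set i | g i <> 1]).
  by rewrite finite_setU.
apply: sub_finite_set fU => i /= fgi; apply/not_andP => -[fi gi].
by apply: fgi; change (f i * (g i)^-1 = 1); rewrite fi gi divgg.
Qed.

Record direct_product := DirectProduct {
  dp_fun : full_product;
  dp_fun_finite : dp_fun \in finitely_supported
}.

HB.instance Definition _ := [isSub for dp_fun].
HB.instance Definition _ := [Choice of direct_product by <:].
HB.instance Definition _ :=
  SubChoice_isSubGroup.Build full_product finitely_supported direct_product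
    finitely_supported_group.

(* The family with value a at i and 1 elsewhere. *)
Definition single (i : I) (a : A i) : full_product :=
  @dfwith {classic I} (fun i => A i) (fun=> 1) i a.

Lemma single_in i (a : A i) : single a i = a.
Proof. exact: (@dfwith_in {classic I}). Qed.

Lemma single_out i j (a : A i) : i <> j -> single a j = 1.
Proof. by move=> ij; apply: (@dfwith_out {classic I}); apply/eqP. Qed.

Fact single_finite i (a : A i) : single a \in finitely_supported.
Proof.
apply/asboolP; apply: sub_finite_set (finite_set1 i) => j /= aj.
by apply: contrapT => ji; apply: aj; apply: single_out => ij; apply: ji.
Qed.

Definition dp_in (i : I) (a : A i) : direct_product :=
  DirectProduct (single_finite a).

Fact dp_in_is_multiplicative i : {morph @dp_in i : a b / a * b}.
Proof.
move=> a b; apply/val_inj; apply: functional_extensionality_dep => j.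
change (single (a * b) j = single a j * single b j).
have [ij|ij] := pselect (i = j); last by rewrite !single_out // mulg1.
by case: j / ij; rewrite !single_in.
Qed.
HB.instance Definition _ i :=
  isMultiplicative.Build (A i) direct_product (@dp_in i)
    (@dp_in_is_multiplicative i).

End DirectProduct.

Section NaturalHom.
Variables (I : Type) (A : I -> groupType).

Definition natural_hom : free_product A -> direct_product A :=
  fp_lift (fun i => @dp_in I A i : {multiplicative A i -> direct_product A}).

HB.instance Definition _ := Multiplicative.on natural_hom.

Lemma natural_hom_in i (a : A i) : natural_hom (fp_in a) = dp_in a.
Proof. exact: fp_lift_in. Qed.

Lemma natural_hom_surj (f : direct_product A) : exists w, natural_hom w = f.
Proof.
have /asboolP/(@finite_seqP {classic I})[s sE] := dp_fun_finite f.
have {sE} : forall i : {classic I}, dp_fun f i <> 1 -> i \in s.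
  by move=> i fi; have : [set` s] i by rewrite -sE.
elim: s f => [|i s IH] f fs.
  exists 1; rewrite [LHS]big_nil; apply/val_inj.
  apply: functional_extensionality_dep => i; apply: contrapT => fi.
  by have := fs i (fun e => fi (esym e)).
have [j|w wE] := IH ((dp_in (dp_fun f i))^-1 * f); last first.
  exists (fp_in (dp_fun f i) * w); rewrite gmulfM /= natural_hom_in wE.
  by rewrite mulgA mulgV mul1g.
rewrite (_ : dp_fun _ j = (single (dp_fun f i) j)^-1 * dp_fun f j) //.
have [ij|ij] := pselect (i = j).
  by case: j / ij; rewrite single_in mulVg.
rewrite single_out // invg1 mul1g => /fs; rewrite inE => /orP[/eqP ji|//].
by case: ij.
Qed.

End NaturalHom.

(* Main.v *)
(* For h != 1, a finite permutation representation of G with a point whose orbit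
   under h has exactly n elements yields the required subgroup: the stabilizer
   of the point.  To get one, conjugate h so that its reduced word
   a_0 ... a_(L-1) is cyclically reduced; as h lies in N and h != 1, it is not
   conjugate into a factor, so L >= 2.  Take nL points in a cycle and let a_t
   move the point t to t+1, indices of a being mod L.  Consecutive syllables
   lie in different factors, so the arrows labelled by one factor are pairwise
   disjoint and each of them extends separately to the regular action of a
   finite quotient of that factor in which a_t survives.  The actions of
   distinct factors need no compatibility, so they define an action of G, under
   which h shifts the cycle by L. *)

Require Import Defs.
From HB Require Import structures.
From mathcomp Require Import all_boot fingroup perm.
From mathcomp Require Import boolp classical_sets functions cardinality.

Set Implicit Arguments.
Unset Strict Implicit.
Unset Printing Implicit Defensive.

Local Open Scope classical_set_scope.
Local Open Scope group_scope.

(** * Potency from finite permutation representations *)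

Lemma multiplicative1 (G H : groupType) (f : {multiplicative G -> H}) : f 1 = 1.
Proof. by apply: (mulgI (f 1)); rewrite -gmulfM !mulg1. Qed.

Lemma multiplicativeV (G H : groupType) (f : {multiplicative G -> H}) x :
  f x^-1 = (f x)^-1.
Proof. by apply: (mulgI (f x)); rewrite -gmulfM !mulgV multiplicative1. Qed.

Lemma kernel_conj (G H : groupType) (f : {multiplicative G -> H}) (g h : G) :
  kernel f h -> kernel f (g^-1 * h * g).
Proof.
rewrite /kernel /= => fh.
by rewrite !gmulfM fh mulg1 -gmulfM mulVg multiplicative1.
Qed.

Definition orbit_of_size (G : groupType) (h : G) (n : nat) : Prop :=
  exists (X : finType) (F : {multiplicative G -> {perm X}}) (x : X),
    forall k, (F (h ^+ k) x == x) = (n %| k)%N.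

(** The element 1 fixes every point, so orbits cannot serve for [n > 1]; the whole group is the
    subgroup instead. *)
Lemma potent1 (G : groupType) : potent (1 : G).
Proof.
move=> n _; exists (fun=> true); split => //.
  have -> : [set` (fun=> true) : {pred G}] = [set: G] by apply/seteqP; split.
  apply: sub_finite_set (finite_set1 [set: G]) => _ [x _ <-].
  apply/seteqP; split => // y _; exists (x^-1 * y) => //.
  by rewrite mulgA mulgV mul1g.
by rewrite expg1n; apply/seteqP; split => x; [case | split].
Qed.

Lemma potent_orbit_of_size (G : groupType) (h : G) :
  (forall n, (0 < n)%N -> orbit_of_size h n) -> potent h.
Proof.
move=> orb n n0; have [X [F [x Fx]]] := orb n n0.
have Fh (k : nat) : (F (h ^- k) x == x) = (n %| k)%N.
  rewrite -Fx multiplicativeV -(inj_eq (@perm_inj _ (F (h ^+ k)))) permKV.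
  by rewrite eq_sym.
exists (fun g => F g x == x); split.
- split=> [|u v /eqP Fu /eqP Fv]; apply/eqP.
    by rewrite multiplicative1 perm1.
  rewrite gmulfM multiplicativeV permM Fu.
  by rewrite -{1}Fv permK.
(* Permutations compose from left to right, so the left coset of [g] is the fibre of [y] mapping to
   [F y^-1 x] over [F g^-1 x]; finiteness of [X] bounds the index. *)
- pose C z := [set y | F y^-1 x = z].
  apply: sub_finite_set (finite_image C (finite_finset (X := setT))).
  move=> _ [g _ <-]; exists (F g^-1 x) => //; apply/seteqP; split => y /=.
    move=> e; exists (g^-1 * y); last by rewrite mulgA mulgV mul1g.
    by apply/eqP; rewrite gmulfM permM -e multiplicativeV permKV.
  move=> [z /eqP Fz <-].
  by rewrite /C /= invgM gmulfM permM (multiplicativeV F z) -{1}Fz permK.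
- apply/seteqP; split => [z [[k kz] Fz] | z [k kz]].
    have {}Fz : F z x == x by [].
    have /dvdnP[q kq] : (n %| k)%N by case: kz Fz => ->; rewrite ?Fx ?Fh.
    by exists q; rewrite -expgnA mulnC -kq.
  split; first by exists (n * k)%N; rewrite expgnA.
  by change (F z x == x); case: kz => ->; rewrite -expgnA ?Fx ?Fh dvdn_mulr.
Qed.

Lemma orbit_of_size_conj (G : groupType) (g h : G) n :
  orbit_of_size (g^-1 * h * g) n -> orbit_of_size h n.
Proof.
(* [h ^+ k] fixes [F g^-1 x] exactly when its conjugate by [g] fixes [x]. *)
move=> [X [F [x Fx]]]; exists X, F, (F g^-1 x) => k.
have conjE : (g^-1 * h * g) ^+ k = g^-1 * (h ^+ k * g).
  elim: k => [|k IH]; first by rewrite !expg0 mul1g mulVg.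
  by rewrite !expgSr IH !mulgA mulgK.
rewrite -Fx conjE -(inj_eq (@perm_inj _ (F g))) -!permM -!gmulfM.
by rewrite mulVg multiplicative1 perm1 mulgA.
Qed.

(** * Actions of the factors on a cycle *)

(* The points of the cycle are the (t, 1); the element a_t should move (t, 1) to
   (t.+1, 1).  Right multiplication moves it to (t, a_t) instead, and the
   involution [glue i] of [cycle_space] exchanges (t, a_t) and (t.+1, 1) for
   the t at which a_t lies in the factor A i. *)
Section CycleAction.
Variables (I : eqType) (A : I -> groupType) (M : nat).
Variable a : 'I_M -> syllable A.
Variables (K : 'I_M -> finGroupType)
  (phi : forall t, {multiplicative A (tag (a t)) -> K t}).
Arguments phi : clear implicits.
Hypothesis phi_neq1 : forall t, phi t (tagged (a t)) != 1.
Hypothesis tag_ordS : forall t, tag (a t) != tag (a (ordS t)).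

Definition cycle_space := {t : 'I_M & K t}.
Implicit Type p : cycle_space.

Definition cycle_point (t : 'I_M) : cycle_space := Tagged K (1 : K t).
Definition cycle_edge (t : 'I_M) : cycle_space :=
  Tagged K (phi t (tagged (a t))).

Definition glue i p : cycle_space :=
  if (tag (a (tag p)) == i) && (p == cycle_edge (tag p)) then
    cycle_point (ordS (tag p))
  else if (tag (a (ord_pred (tag p))) == i) && (p == cycle_point (tag p)) then
    cycle_edge (ord_pred (tag p))
  else p.

Definition block_mul i (b : A i) p : cycle_space :=
  if tag (a (tag p)) == i then
    Tagged K (tagged p * phi (tag p) (tagged_as (a (tag p)) (Tagged A b)))
  else p.

Lemma edge_neq_point t : cycle_edge t != cycle_point t.
Proof. by rewrite eq_Tagged. Qed.

Lemma glue_edge t : glue (tag (a t)) (cycle_edge t) = cycle_point (ordS t).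
Proof. by rewrite /glue /= !eqxx. Qed.

Lemma glue_next t : glue (tag (a t)) (cycle_point (ordS t)) = cycle_edge t.
Proof.
by rewrite /glue /= eq_sym (negPf (tag_ordS t)) /= ordSK !eqxx.
Qed.

(** The only exchange moving [(t, 1)] belongs to the preceding syllable, which lies in another
    factor. *)
Lemma glue_point t : glue (tag (a t)) (cycle_point t) = cycle_point t.
Proof.
rewrite /glue /= eqxx /= eq_sym (negPf (edge_neq_point t)).
by have := tag_ordS (ord_pred t); rewrite ord_predK => /negPf ->.
Qed.

Lemma glueK i : involutive (glue i).
Proof.
move=> p; rewrite {2}/glue.
case: ifP => [/andP[/eqP <- /eqP ep]|H1]; first by rewrite glue_next -ep.
case: ifP => [/andP[/eqP <- /eqP ep]|H2].
  by rewrite glue_edge ord_predK -ep.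
by rewrite /glue H1 H2.
Qed.

Lemma block_mulM i (b c : A i) p :
  block_mul (b * c) p = block_mul c (block_mul b p).
Proof.
rewrite /block_mul; case: p => t k /=.
have [e|ne] := eqVneq (tag (a t)) i; last by rewrite (negPf ne).
by case: i / e b c => b c /=; rewrite eqxx !tagged_asE gmulfM mulgA.
Qed.

Lemma block_mul1 i p : block_mul (1 : A i) p = p.
Proof.
rewrite /block_mul; case: p => t k /=.
have [e|//] := eqVneq (tag (a t)) i.
by case: i / e; rewrite tagged_asE multiplicative1 mulg1.
Qed.

(** Conjugating by an involution preserves the action law, while the outer [glue] redirects the
    arrow ending at [(t, a_t)] to [(t.+1, 1)]. *)
Definition glued_mul i (b : A i) p := glue i (block_mul b (glue i p)).

Lemma glued_mul_inj i (b : A i) : injective (glued_mul b).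
Proof.
apply: (can_inj (g := glued_mul b^-1)) => p.
by rewrite /glued_mul glueK -block_mulM mulgV block_mul1 glueK.
Qed.

Definition cycle_action i (b : A i) : {perm cycle_space} :=
  perm (@glued_mul_inj i b).

Fact cycle_action_is_multiplicative i : {morph @cycle_action i : b c / b * c}.
Proof.
move=> b c; apply/permP => p.
by rewrite permM !permE /glued_mul glueK block_mulM.
Qed.
HB.instance Definition _ i :=
  isMultiplicative.Build (A i) {perm cycle_space} (@cycle_action i)
    (@cycle_action_is_multiplicative i).

Lemma cycle_action_point t :
  cycle_action (tagged (a t)) (cycle_point t) = cycle_point (ordS t).
Proof.
rewrite permE /glued_mul glue_point -glue_edge; congr glue.
by rewrite /block_mul /= eqxx tagged_asE mul1g.
Qed.

End CycleAction.

(** * Orbits of cyclically reduced words, and reduction to them *)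

Section FreeProductOrbits.
Variables (I : Type) (A : I -> groupType).
Implicit Types (h : free_product A) (x y : @syllable {classic I} A).
Implicit Type w : seq (@syllable {classic I} A).

Lemma fp_cons x w (rw : reduced (x :: w)) :
  FreeProduct rw = fp_in (tagged x) * FreeProduct (reduced_behead rw).
Proof.
case: x rw => i b rw; have rw' := reduced_behead rw.
by apply/val_inj; rewrite /= [RHS]foldr_push //= push_red.
Qed.

Lemma prod_perm_path (X : finType)
    (f : forall i, {multiplicative A i -> {perm X}}) c w (y : nat -> X) k :
  (forall j, (j < size w)%N ->
     f (tag (nth c w j)) (tagged (nth c w j)) (y (k + j)%N) = y (k + j).+1) ->
  (\prod_(x <- w) f (tag x) (tagged x)) (y k) = y (k + size w)%N.
Proof.
elim: w k => [|x w IH] k fy; first by rewrite big_nil perm1 addn0.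
have := fy 0 isT; rewrite /= addn0 big_cons permM => ->.
rewrite IH ?addSnnS // => j jw.
by have := fy j.+1 jw; rewrite /= addSnnS.
Qed.

(** Appending [c] to [s] makes the path condition cyclic; it also forces [s] to be nonempty. *)
Lemma orbit_of_size_cyclic (hA : forall i, residually_finite (A i)) h n
    (c : @syllable {classic I} A) s : (0 < n)%N -> word h = c :: s ->
  path (fun x y : syllable _ => tag x != tag y) c (rcons s c) ->
  orbit_of_size h n.
Proof.
move=> n0 hs cyc.
pose L := size (word h).
have L0 : (0 < L)%N by rewrite /L hs.
have nL0 : (0 < n * L)%N by rewrite muln_gt0 n0.
pose ith k := nth c (word h) (k %% L).
have ith_neq1 k : tagged (ith k) != 1.
  have /andP[/(all_nthP c) + _] := word_reduced h.
  by apply; rewrite ltn_pmod.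
have tag_ithS k : tag (ith k) != tag (ith k.+1).
  have /(pathP c)/(_ (k %% L)) := cyc.
  rewrite size_rcons -[(size s).+1]/(size (c :: s)) -hs.
  (* What remains is to split off the wrap-around from the last syllable to the first. *)
  move=> /(_ (ltn_pmod _ L0)).
  rewrite /ith -addn1 -modnDml addn1 hs.
  have := ltn_pmod k L0; rewrite leq_eqVlt => /orP[/eqP kL|kL].
    rewrite kL modnn /=.
    move: kL; rewrite {2}/L hs /= => -[->].
    rewrite nth_rcons ltnn eqxx.
    by rewrite -[c :: rcons s c]rcons_cons nth_rcons /= leqnn.
  rewrite (modn_small kL) /= -rcons_cons !nth_rcons /=.
  move: kL; rewrite {2}/L hs /= ltnS => kL.
  by rewrite kL (ltn_trans kL).
pose a (t : 'I_(n * L)) := ith t.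
(* As [L] divides [n * L], going round the cycle respects the period of [ith]. *)
have tag_aS t : tag (a t) != tag (a (ordS t)).
  by rewrite {2}/a /ith /= modn_dvdm ?dvdn_mull //; apply: tag_ithS.
pose quo t := cid (hA _ _ (ith_neq1 (t : 'I_(n * L)))).
pose K t : finGroupType := projT1 (quo t).
pose phi t : {multiplicative _ -> K t} := projT1 (cid (projT2 (quo t))).
have phi_neq1 t : phi t (tagged (a t)) != 1 := projT2 (cid (projT2 (quo t))).
pose f i : {multiplicative A i -> {perm cycle_space K}} :=
  @cycle_action _ _ _ a _ phi tag_aS i.
pose y k := @cycle_point _ K (Ordinal (ltn_pmod k nL0)).
exists (cycle_space K), (fp_lift f), (y 0) => k.
have fy j : f (tag (ith j)) (tagged (ith j)) (y j) = y j.+1.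
  rewrite /f /y.
  have -> : ith j = a (Ordinal (ltn_pmod j nL0)).
    by rewrite /a /ith /= modn_dvdm ?dvdn_mull.
  rewrite cycle_action_point //; congr cycle_point; apply/val_inj => /=.
  by rewrite -addn1 modnDml addn1.
have -> : fp_lift f (h ^+ k) (y 0) = y (k * L)%N.
  elim: k => [|k IH]; first by rewrite multiplicative1 perm1.
  rewrite expgSr gmulfM permM IH mulSnr.
  apply: (@prod_perm_path _ _ c) => j jL.
  by rewrite -fy /ith modnMDl modn_small.
(* Return to the start means that [n * L] divides [k * L], where [L > 0]. *)
apply/eqP/idP => [/(congr1 (val \o tag)) /= e|/dvdnP[q ->]].
  by rewrite -(dvdn_pmul2r L0) /dvdn e mod0n.
rewrite /y; congr cycle_point; apply/val_inj => /=.
by rewrite -mulnA modnMl mod0n.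
Qed.

Lemma size_push x w : (size (push x w) <= (size w).+1)%N.
Proof.
rewrite /push; case: ifP => // _; case: w => //= y w.
by case: ifP => //= _; case: ifP => //= _; rewrite ltnW.
Qed.

(** Merging two syllables of one factor saves a letter, which makes the conjugation below shorten
    the word. *)
Lemma size_push_cons x y w :
  tag x = tag y -> (size (push x (y :: w)) <= (size w).+1)%N.
Proof.
move=> /eqP xy; rewrite /push; case: ifP => // _.
by rewrite ifT //; case: ifP.
Qed.

Lemma size_foldr_push u w : (size (foldr (@push _ _) w u) <= size u + size w)%N.
Proof. by elim: u => //= x u IH; apply: leq_trans (size_push _ _) _. Qed.

Lemma natural_hom_fp_in_eq1 (i : I) (b : A i) :
  natural_hom (fp_in b) = 1 -> b = 1.
Proof.
rewrite natural_hom_in => /(congr1 (fun d => dp_fun d i)).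
by rewrite /= single_in.
Qed.

(** Induction on word length: if the end syllables share a factor, conjugating by the first one
    moves it to the end, where it merges with the last. *)
Lemma orbit_of_size_kernel (hA : forall i, residually_finite (A i)) h n :
  kernel (@natural_hom I A) h -> h <> 1 -> (0 < n)%N -> orbit_of_size h n.
Proof.
move=> hN h1 n0; have [m] := ubnP (size (word h)).
elim: m h hN h1 => // m IH [[|x s] rw] hN h1; first by case: h1; apply/val_inj.
case: (lastP s) rw hN h1 => {s} [|s y] rw hN h1 /= sm.
  (* A single syllable is impossible, the natural map being injective on each factor. *)
  move: hN; rewrite fp_cons (_ : FreeProduct _ = 1); last exact/val_inj.
  rewrite mulg1 => /natural_hom_fp_in_eq1 x1.
  by have := rw; rewrite {1}/reduced /= x1 eqxx.
have [yx|yx] := eqVneq (tag y) (tag x); last first.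
  apply: (@orbit_of_size_cyclic hA _ n x (rcons s y)) => //.
  rewrite rcons_path last_rcons yx andbT.
  by have /andP[_] := rw.
set h := FreeProduct rw.
apply: (@orbit_of_size_conj _ (fp_in (tagged x))).
have hx : (fp_in (tagged x))^-1 * h = FreeProduct (reduced_behead rw).
  by rewrite /h fp_cons mulKg.
apply: IH.
- exact: (@kernel_conj _ _ (@natural_hom I A : {multiplicative _ -> _})).
- move=> e; apply: h1; rewrite -/h -[h](mulKVg (fp_in (tagged x))).
  by rewrite -[_^-1 * h](mulgK (fp_in (tagged x))) e mul1g mulgV.
rewrite hx /= foldr_rcons.
have rx : reduced [:: x].
  have := rw; rewrite {1}/reduced /= => /andP[/andP[x1 _] _].
  by rewrite /reduced /= x1.
rewrite (_ : push (Tagged _ _) [::] = [:: x]); last first.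
  by rewrite -(push_red rx); case: (x).
apply: leq_ltn_trans (size_foldr_push _ _) _.
rewrite size_rcons ltnS in sm; apply: leq_ltn_trans sm.
by rewrite -addn1 leq_add2l size_push_cons.
Qed.

End FreeProductOrbits.

Theorem theorem2 (I : Type) (A : I -> groupType)
  (hA : forall i : I, residually_finite (A i))
  (h : free_product A) (hN : kernel (@natural_hom I A) h) :
  potent h.
Proof.
have [->|/eqP h1] := eqVneq h 1; first exact: potent1.
by apply: potent_orbit_of_size => n; apply: orbit_of_size_kernel.
Qed.
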